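(* Let $H$ be a hypergraph with no isolated vertices, and let $p\in(0,1)$. If every edge in $H$ is flammable with respect to $p$, then $b_{L,p}(H)<b_p(H)$.
   Context: A hypergraph $H=(V(H),E(H))$ has a finite nonempty vertex set and a finite collection $E(H)$ of subsets of $V(H)$ called edges (parallel edges allowed); a vertex is isolated if it lies in no edge. An edge $e$ is non-flammable with respect to $p$ if $\lceil p|e|\rceil=|e|$, and flammable otherwise. For a proportion $p\in(0,1)$, the proportion-based propagation rule is: if at the end of a round at least $\lceil p|e|\rceil$ vertices of an edge $e$ are on fire, then in the next round all vertices of $e$ catch fire; burned vertices stay burned. Burning game: let $F_0=\emptyset$ and $F_r$ be the set of burned vertices at the end of round $r$. In each round $r\geq 1$, simultaneously, vertices catch fire by propagation from $F_{r-1}$ (no propagation in round 1), and a player chooses a vertex $u_r\notin F_{r-1}$ (a source) and sets it on fire. A burning sequence is a sequence $(u_1,\ldots,u_k)$ of such sources after which every vertex is on fire at the end of round $k$; $b_p(H)$ is the minimum length of a burning sequence. Lazy game: $S\subseteq V(H)$ is a lazy burning set if, setting all of $S$ on fire at once and then repeatedly applying the propagation rule, every vertex eventually catches fire; $b_{L,p}(H)$ is the minimum size of a lazy burning set. *)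

(* Defs.v *)
From mathcomp Require Import all_boot all_order all_algebra.
From mathcomp Require Import boolp reals.

Set Implicit Arguments.
Unset Strict Implicit.
Unset Printing Implicit Defensive.

Import Order.TTheory GRing.Theory Num.Theory.
Local Open Scope ring_scope.

(* The edges form a list, so parallel edges are allowed; its order is never
   used. *)
Record hypergraph := Hypergraph {
  vertex :> finType;
  edges : seq {set vertex};
  vertex_nonempty : (0 < #|vertex|)%N
}.

Definition isolated (H : hypergraph) (v : H) : Prop :=
  forall e, e \in edges H -> v \notin e.

Definition non_flammable (R : realType) (p : R) (V : finType) (e : {set V}) :
  Prop := Num.ceil (p * #|e|%:R) = #|e|%:Z.

Definition flammable (R : realType) (p : R) (V : finType) (e : {set V}) :
  Prop := ~ non_flammable p e.

Definition propagate (R : realType) (p : R) (H : hypergraph) (F : {set H}) :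
    {set H} :=
  F :|: \bigcup_(e <- edges H | Num.ceil (p * #|e|%:R) <= #|e :&: F|%:Z) e.

(* [on_fire p [:: u_1; ...; u_r]] is the set F_r of vertices burned at the end
   of round r.  Round 1 propagates from the empty set, which ignites nothing
   when 0 < p: a nonempty edge has a positive threshold. *)
Definition on_fire (R : realType) (p : R) (H : hypergraph) (s : seq H) :
    {set H} :=
  foldl (fun F u => u |: propagate p F) set0 s.

(* Indices start at 0: the source of round r.+1 is [tnth u r], and it must lie
   outside F_r. *)
Definition burning_sequence (R : realType) (p : R) (H : hypergraph) (k : nat)
    (u : k.-tuple H) : Prop :=
  (forall r : 'I_k, tnth u r \notin on_fire p (take r u)) /\
  on_fire p u = [set: H].

Definition lazy_burning_set (R : realType) (p : R) (H : hypergraph)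
    (S : {set H}) : Prop :=
  exists n, iter n (propagate p (H := H)) S = [set: H].

Lemma burning_sequence_exists (R : realType) (p : R) (H : hypergraph) :
  exists k, `[< exists u : k.-tuple H, burning_sequence p u >].
Proof.
suff: forall n (s : seq H), (#|~: on_fire p s| <= n)%N ->
    (forall s1 u s2, s = s1 ++ u :: s2 -> u \notin on_fire p s1) ->
    exists t : seq H, on_fire p t = [set: H] /\
      forall s1 u s2, t = s1 ++ u :: s2 -> u \notin on_fire p s1.
  case/(_ _ [::] (leqnn _)) => [[]//|t [tT tu]].
  exists (size t); apply/asboolP; exists (in_tuple t); split=> // r.
  apply: (tu _ _ (drop r.+1 t)).
  by rewrite (tnth_nth (tnth (in_tuple t) r)) /= -drop_nth // cat_take_drop.
elim=> [|n IHn] s.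
  rewrite leqn0 cards_eq0 => /eqP s0 us; exists s; split=> //.
  by rewrite -[LHS]setCK s0 setC0.
have [sT|] := eqVneq (on_fire p s) [set: H]; first by exists s.
rewrite -subTset => /subsetPn [v _ vs] ns us.
apply: (IHn (rcons s v)).
  rewrite -ltnS (leq_trans _ ns) ?proper_card // properE.
  rewrite /on_fire foldl_rcons -/(on_fire p s).
  apply/andP; split.
    rewrite setCS; apply/subsetP=> x xs; rewrite !inE.
    by apply/orP; right; apply/orP; left.
  by apply/subsetPn; exists v; rewrite !inE ?vs ?eqxx.
move=> s1 u s2; elim/last_ind: s2 => [|s2 w _].
  by rewrite cats1 => /rcons_inj [<- <-].
by rewrite -rcons_cons -rcons_cat => /rcons_inj [/us].
Qed.

Lemma lazy_burning_set_exists (R : realType) (p : R) (H : hypergraph) :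
  exists k, `[< exists S : {set H}, #|S| = k /\ lazy_burning_set p S >].
Proof.
exists #|H|; apply/asboolP; exists setT; rewrite cardsT; split=> //.
by exists 0%N.
Qed.

Definition burning_number (R : realType) (p : R) (H : hypergraph) : nat :=
  ex_minn (burning_sequence_exists p H).

Definition lazy_burning_number (R : realType) (p : R) (H : hypergraph) : nat :=
  ex_minn (lazy_burning_set_exists p H).

(* Main.v *)
Require Import Defs.
From mathcomp Require Import all_boot all_order all_algebra.
From mathcomp Require Import boolp reals.
Import Order.TTheory GRing.Theory Num.Theory.
Local Open Scope ring_scope.

(** In a shortest burning sequence all vertices except possibly the last source
    [w] burn by propagation from the earlier sources, and they still do when
    these sources are all lit at once.  An edge through [w] then has at most
    one unburned vertex, and a flammable edge propagates from all but one of
    its vertices; so the sources without [w] form a lazy burning set. *)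

Lemma in_propagate (R : realType) (p : R) (H : hypergraph) (F : {set H}) x :
  reflect (x \in F \/ exists e, [/\ e \in edges H,
             Num.ceil (p * #|e|%:R) <= #|e :&: F|%:Z & x \in e])
          (x \in propagate p F).
Proof.
rewrite inE -big_filter bigcup_seq.
apply: (iffP orP) => [[xF|/bigcupP[e]]|[xF|[e [eH eF xe]]]].
- by left.
- by rewrite mem_filter => /andP[eF eH] xe; right; exists e.
- by left.
- by right; apply/bigcupP; exists e => //; rewrite mem_filter eF.
Qed.

Lemma propagate_sub (R : realType) (p : R) (H : hypergraph) (F : {set H}) :
  F \subset propagate p F.
Proof. exact: subsetUl. Qed.

Lemma propagateS (R : realType) (p : R) (H : hypergraph) (F G : {set H}) :
  F \subset G -> propagate p F \subset propagate p G.
Proof.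
move=> sFG; apply/subsetP => x /in_propagate[xF|[e [eH eF xe]]].
  by apply/in_propagate; left; apply: (subsetP sFG).
apply/in_propagate; right; exists e; split=> //.
by apply: le_trans eF _; rewrite lez_nat subset_leq_card // setIS.
Qed.

Lemma iter_propagateS (R : realType) (p : R) (H : hypergraph) n (F G : {set H}) :
  F \subset G -> iter n (propagate p (H := H)) F \subset
                 iter n (propagate p (H := H)) G.
Proof. by move=> sFG; elim: n => //= n; apply: propagateS. Qed.

Lemma sub_iter_propagate (R : realType) (p : R) (H : hypergraph) n (F : {set H}) :
  F \subset iter n (propagate p (H := H)) F.
Proof.
by elim: n => //= n /subset_trans; apply; apply: propagate_sub.
Qed.

Lemma on_fire_rcons (R : realType) (p : R) (H : hypergraph) (s : seq H) w :
  on_fire p (rcons s w) = w |: propagate p (on_fire p s).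
Proof. by rewrite /on_fire foldl_rcons. Qed.

(** Induction on the rounds: lighting a source at the start instead of in its own round can only
    enlarge the burned set, as propagation is monotone. *)
Lemma on_fire_sub_lazy (R : realType) (p : R) (H : hypergraph) (s : seq H) :
  on_fire p s \subset iter (size s) (propagate p (H := H)) [set x in s].
Proof.
elim/last_ind: s => [|s w IHs]; first exact: sub0set.
rewrite on_fire_rcons size_rcons subUset sub1set; apply/andP; split.
  by rewrite (subsetP (sub_iter_propagate _ _ _ _ _)) // inE mem_rcons mem_head.
rewrite iterS; apply: propagateS; apply: subset_trans IHs _.
apply: iter_propagateS; apply/subsetP => x; rewrite !inE mem_rcons inE => ->.
by rewrite orbT.
Qed.

(** For [p < 1], the integer [#|e|] bounds [p * #|e|] and hence its ceiling; flammability excludes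
    equality. *)
Lemma flammable_threshold (R : realType) (p : R) (V : finType) (e : {set V}) :
  p < 1 -> flammable p e -> Num.ceil (p * #|e|%:R) < #|e|%:Z.
Proof.
move=> p_lt1 fl_e; rewrite lt_neqAle; apply/andP; split; first exact/eqP.
by rewrite ceil_le_int -pmulrn ler_piMl // ltW.
Qed.

Lemma propagate_full (R : realType) (p : R) (H : hypergraph) (F : {set H}) w :
  p < 1 -> ~ isolated w ->
  (forall e : {set H}, e \in edges H -> flammable p e) ->
  w |: F = [set: H] -> propagate p F = [set: H].
Proof.
move=> p_lt1 w_nisol fl FT; apply/eqP; rewrite -subTset -FT subUset sub1set.
rewrite propagate_sub andbT; apply/in_propagate; right.
have [e eH we] : exists2 e, e \in edges H & w \in e.
  apply: contrapT => no_e; apply: w_nisol => e eH.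
  by apply/negP => we; apply: no_e; exists e.
exists e; split=> //.
(* Only [w] can be missing from [F], so [e] has at most one unburned vertex. *)
have : (#|e| <= #|e :&: F|.+1)%N.
  rewrite (cardsD1 w e) we add1n ltnS subset_leq_card //.
  apply/subsetP => x; rewrite !inE => /andP[xw ->] /=.
  by have := in_setT x; rewrite -FT !inE (negPf xw).
(* The threshold is an integer strictly below [#|e|], hence at most [#|e :&: F|]. *)
rewrite -lez_nat; move/(lt_le_trans (flammable_threshold _ _ _ _ p_lt1 (fl e eH))).
by rewrite -addn1 PoszD ltzD1.
Qed.

Theorem theorem2p15 (R : realType) (H : hypergraph) (p : R)
  (p_gt0 : 0 < p) (p_lt1 : p < 1)
  (no_isolated : forall v : H, ~ isolated v)
  (all_flammable : forall e : {set H}, e \in edges H -> flammable p e) :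
  (lazy_burning_number p H < burning_number p H)%N.
Proof.
rewrite /burning_number; case: ex_minnP => k /asboolP[u [_ uT]] _.
rewrite -(size_tuple u).
rewrite /lazy_burning_number; case: ex_minnP => l _ l_min.
(* The empty sequence burns nothing, while [H] has a vertex; so there is a last source [w], and a
   lazy burning set of size at most [size s] suffices. *)
case/lastP: (tval u) uT => [|s w] uT.
  by have := vertex_nonempty H; rewrite -cardsT -uT cards0.
rewrite size_rcons ltnS.
apply: (@leq_trans #|[set x in s]|); last by rewrite cardsE card_size.
apply: l_min; apply/asboolP; exists [set x in s]; split=> //.
(* [size s] propagations cover the fire after [s], one more covers the propagation of the last
   round, and the final one burns [w]. *)
exists (size s).+2; rewrite !iterS.
apply: (propagate_full _ _ _ _ w) => //; apply/eqP.
rewrite -subTset -uT on_fire_rcons setUS // propagateS //.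
exact: on_fire_sub_lazy.
Qed.
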